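(* Let $\mathcal{B}$ be the set of eigenfunctions of the Laplace–Beltrami operator on the round unit sphere $\mathbb{S}^2$ consisting of the functions $P_n(\cos\theta)$ together with the functions $P_n^m(\cos\theta)\cos(m\varphi)$ and $P_n^m(\cos\theta)\sin(m\varphi)$ for $1\le m\le n$. For any sequence $(\psi_n)_{n\ge1}$ of eigenfunctions $\psi_n\in\mathcal{B}$ such that $\psi_n$ has eigenvalue $n(n+1)$ (that is, $\psi_n$ is one of the elements of $\mathcal{B}$ of degree $n$), $$\lim_{n\rightarrow\infty}\frac{\operatorname{vol}\{x\in\mathbb{S}^2:\psi_n(x)>0\}}{\operatorname{vol}\{x\in\mathbb{S}^2:\psi_n(x)<0\}}=1.$$
   Context: Here $P_n$ is the Legendre polynomial of degree $n$, $P_n^m$ are the associated Legendre polynomials (functions), $\theta\in[0,\pi]$ is the polar angle and $\varphi\in[0,2\pi)$ the azimuthal angle on $\mathbb{S}^2$, and $\operatorname{vol}$ is surface area on $\mathbb{S}^2$. Eigenvalues are those of $-\Delta_{\mathbb{S}^2}$. Linear combinations of the listed functions are not included in $\mathcal{B}$. *)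

(* Defs.v *)
From HB Require Import structures.
From mathcomp Require Import all_boot all_order all_algebra.
From mathcomp Require Import all_classical all_reals all_analysis.
From mathcomp Require Import ring lra.

Set Implicit Arguments.
Unset Strict Implicit.
Unset Printing Implicit Defensive.

Import Order.TTheory GRing.Theory Num.Theory.
Import numFieldNormedType.Exports.

Local Open Scope classical_set_scope.
Local Open Scope ring_scope.

Section Sphere.
Variable R : realType.

Definition in_sphere2 (p : R * R * R) : bool :=
  p.1.1 ^+ 2 + p.1.2 ^+ 2 + p.2 ^+ 2 == 1.

Definition sphere2 : Type := {p : R * R * R | in_sphere2 p}.

Definition xcoord (x : sphere2) : R := (val x).1.1.
Definition ycoord (x : sphere2) : R := (val x).1.2.
Definition zcoord (x : sphere2) : R := (val x).2.

Lemma spherical_subproof (theta phi : R) :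
  in_sphere2 (sin theta * cos phi, sin theta * sin phi, cos theta).
Proof.
rewrite /in_sphere2 /= !exprMn -mulrDr [cos phi ^+ 2 + _]cos2Dsin2 mulr1.
by rewrite addrC cos2Dsin2.
Qed.

Definition spherical (theta phi : R) : sphere2 :=
  exist _ (sin theta * cos phi, sin theta * sin phi, cos theta)
    (spherical_subproof theta phi).

Definition polar_angle (x : sphere2) : R := acos (zcoord x).

(* At the two poles, where no azimuth is defined, the value is the arbitrary
   number pi / 2. *)
Definition azimuth (x : sphere2) : R :=
  let a := acos (xcoord x / Num.sqrt (xcoord x ^+ 2 + ycoord x ^+ 2)) in
  if 0 <= ycoord x then a else pi *+ 2 - a.

Lemma polar_angle_itv (x : sphere2) : 0 <= polar_angle x <= pi.
Proof.
case: x => -[[a b] c] /= h; rewrite /polar_angle /zcoord /=.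
have /eqP/= e := h.
have hc : -1 <= c <= 1 by nra.
by rewrite acos_ge0 // acos_lepi.
Qed.

Lemma azimuth_arg_itv (a b : R) : -1 <= a / Num.sqrt (a ^+ 2 + b ^+ 2) <= 1.
Proof.
rewrite -ler_norml normrM normfV [`|Num.sqrt _|]ger0_norm ?sqrtr_ge0 //.
have [->|n0] := eqVneq (Num.sqrt (a ^+ 2 + b ^+ 2)) 0.
  by rewrite invr0 mulr0 ler01.
have s0 : 0 < Num.sqrt (a ^+ 2 + b ^+ 2) by rewrite lt_def n0 sqrtr_ge0.
rewrite ler_pdivrMr // mul1r -sqrtr_sqr ler_wsqrtr // lerDl; exact: sqr_ge0.
Qed.

Lemma azimuth_itv (x : sphere2) : 0 <= azimuth x < pi *+ 2.
Proof.
case: x => -[[a b] c] h; rewrite /azimuth /xcoord /ycoord /=.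
have i := azimuth_arg_itv a b; have p0 := pi_gt0 R.
have l := acos_lepi i; have g := acos_ge0 i.
case: ifPn => [_|]; first by apply/andP; split; lra.
rewrite -ltNge => b0.
suff : 0 < acos (a / Num.sqrt (a ^+ 2 + b ^+ 2)) by move=> ?; apply/andP; split; lra.
apply: acos_gt0; case/andP: (i) => -> /=; rewrite le_eqVlt.
case: eqVneq => [e _|//]; exfalso; have b2 : 0 < b ^+ 2 by rewrite exprn_even_gt0 //= lt_eqF.
have t0 : 0 < a ^+ 2 + b ^+ 2 by have := sqr_ge0 a; lra.
have ts := sqr_sqrtr (ltW t0).
have s0 : Num.sqrt (a ^+ 2 + b ^+ 2) != 0 by rewrite gt_eqF // sqrtr_gt0.
have ea : a = Num.sqrt (a ^+ 2 + b ^+ 2) by rewrite -[LHS](divfK s0) e mul1r.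
by move: ts; rewrite -ea; lra.
Qed.

Lemma spherical_polar_azimuth (x : sphere2) :
  spherical (polar_angle x) (azimuth x) = x.
Proof.
have i1 : -1 <= zcoord x <= 1.
  by case: x => -[[a b] c] /= h; have /eqP/= e := h; rewrite /zcoord /=; nra.
apply: val_inj; rewrite /= /polar_angle acosK ?in_itv //= sin_acos //.
case: x i1 => -[[a b] c] /= h; rewrite /azimuth /xcoord /ycoord /zcoord /= => i1.
have /eqP/= e := h; have i := azimuth_arg_itv a b.
have -> : 1 - c ^+ 2 = a ^+ 2 + b ^+ 2 by lra.
set s := Num.sqrt _ in i *.
have t0 : 0 <= a ^+ 2 + b ^+ 2 by rewrite addr_ge0 ?sqr_ge0.
have ss : s ^+ 2 = a ^+ 2 + b ^+ 2 by rewrite sqr_sqrtr.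
have sg : 0 <= s by exact: sqrtr_ge0.
have [s0|s0] := eqVneq s 0.
  have a0 : a = 0 by move: ss; rewrite s0; have := sqr_ge0 b; nra.
  have b0 : b = 0 by move: ss; rewrite s0 a0; nra.
  by rewrite s0 !mul0r a0 b0.
have key : s * Num.sqrt (1 - (a / s) ^+ 2) = `|b|.
  rewrite -[s in s * _](ger0_norm sg) -sqrtr_sqr -sqrtrM ?sqr_ge0 //.
  rewrite mulrBr mulr1 -exprMn mulrC -mulrA mulVf // mulr1 ss addrC addKr.
  by rewrite sqrtr_sqr.
have cx : s * (a / s) = a by rewrite mulrC divfK.
case: ifPn => [b0|].
  by rewrite acosK ?in_itv // sin_acos // key ger0_norm // cx.
rewrite -ltNge => b0.
have -> u : pi *+ 2 - u = - u + pi *+ 2 :> R by rewrite addrC.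
by rewrite cosD2pi sinD2pi cosN sinN acosK ?in_itv // sin_acos // mulrN key
  ltr0_norm // opprK cx.
Qed.

(* Surface area: the area element of the unit sphere in spherical coordinates
   is sin theta dtheta dphi. *)
Definition vol (A : set sphere2) : \bar R :=
  (\int[lebesgue_measure \x lebesgue_measure]_(p in
     [set p : R * R | [/\ 0 <= p.1 <= pi, 0 <= p.2 < pi *+ 2
                        & A (spherical p.1 p.2)]]%R)
   (sin p.1)%:E)%E.

(* The Laplace-Beltrami operator of the round metric
   dtheta^2 + (sin theta)^2 dphi^2, evaluated at spherical theta phi; the
   expression is meaningful away from the poles, i.e. for 0 < theta < pi. *)
Definition laplace_beltrami (f : sphere2 -> R) (theta phi : R) : R :=
  (sin theta)^-1 *
    derive1 (fun t => sin t * derive1 (fun s => f (spherical s phi)) t) theta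
  + (sin theta ^+ 2)^-1 *
    derive1 (fun q => derive1 (fun p => f (spherical theta p)) q) phi.

(* The equation is imposed off the poles only; for a smooth f it extends to
   them by continuity. *)
Definition is_eigenfunction (f : sphere2 -> R) (lambda : R) : Prop :=
  (exists x, f x != 0) /\
  forall theta phi, 0 < theta < pi ->
    - laplace_beltrami f theta phi = lambda * f (spherical theta phi).

(* Rodrigues' formula. *)
Definition legendre (n : nat) : {poly R} :=
  ((2 ^ n * n`!)%:R)^-1 *: derivn n (('X^2 - 1) ^+ n).

(* With the Condon-Shortley phase (-1)^m. *)
Definition assoc_legendre (n m : nat) (t : R) : R :=
  (-1) ^+ m * Num.sqrt (1 - t ^+ 2) ^+ m * (derivn m (legendre n)).[t].

Definition zonal (n : nat) (x : sphere2) : R :=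
  (legendre n).[cos (polar_angle x)].

Definition harmonic_cos (n m : nat) (x : sphere2) : R :=
  assoc_legendre n m (cos (polar_angle x)) * cos (m%:R * azimuth x).

Definition harmonic_sin (n m : nat) (x : sphere2) : R :=
  assoc_legendre n m (cos (polar_angle x)) * sin (m%:R * azimuth x).

Definition standard_basis : set (sphere2 -> R) :=
  [set f | exists n, f = zonal n \/
     exists m, (1 <= m <= n)%N /\ (f = harmonic_cos n m \/ f = harmonic_sin n m)].

End Sphere.

(* Main.v *)
Require Import Defs.
From mathcomp Require Import all_boot all_order all_algebra.
From mathcomp Require Import all_classical all_reals all_analysis.
From mathcomp Require Import measurable_realfun ring lra.
Import Order.TTheory GRing.Theory Num.Theory.
Import numFieldNormedType.Exports.
Local Open Scope classical_set_scope.
Local Open Scope ring_scope.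

(** Write V and W for the areas of the sets where an eigenfunction psi is positive
and negative. Every member of the basis is a product F(theta) G(phi) in spherical
coordinates, so V - W is the product of the imbalances of F (for the measure
sin theta dtheta on [0, pi]) and of G (for dphi on [0, 2 pi]), while
V + W = 4 pi because the zero set is null ([vol_sign_split]). It suffices to show
that V - W tends to 0.

Both imbalances are controlled by one estimate ([sign_imbalance_le]). Suppose
(s y')' + l ^ 2 s y = 0 on [a, b]. The folded Pruefer phase
A = atan (y' / (l |y|)) is bounded by pi / 2, and the equation gives
  (s A)' = - l s sign y + s' (A - B),   B = l y' |y| / (l ^ 2 y ^ 2 + y' ^ 2),
with |B| <= 1 / 2.
If s A takes the same value at both ends, integration yields
  l |int s sign y| <= (pi / 2 + 1 / 2) (b - a) sup |s'|.
Replacing |y| by sqrt (y ^ 2 + d ^ 2) makes this rigorous without any knowledge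
of the zeros of y; d tends to 0 at the end.

With s = 1 and y = sin (m phi + c) the right-hand side is 0: the azimuthal factors
with m > 0 are exactly balanced, and V = W ([sin_affine_balanced]). With s = sin
and y a zonal function, the eigenvalue equation has the required form with
l ^ 2 = n (n + 1), and the imbalance of a zonal function is O (1 / n)
([poly_cos_imbalance]). *)

Set Implicit Arguments.
Unset Strict Implicit.

(** * Calculus and measurability on the line *)

Lemma is_derive_continuous (R : realType) (g dg : R -> R) :
  (forall x : R, is_derive x 1 g (dg x)) -> continuous g.
Proof.
by move=> Dg x; apply/differentiable_continuous/derivable1_diffP; case: (Dg x).
Qed.

Lemma integrable_continuous_itv (R : realType) (a b : R) (s : R -> R) :
  continuous s -> lebesgue_measure.-integrable `[a, b] (EFin \o s).
Proof.
move=> cs; apply: continuous_compact_integrable; first exact: segment_compact.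
exact: continuous_subspaceT.
Qed.

Lemma measurable_gt0 (R : realType) (y : R -> R) : continuous y ->
  measurable [set x | 0 < y x].
Proof.
move=> cy; apply: open_measurable.
by apply: (@open_comp _ _ y [set r | 0 < r]) => [x _|]; [exact: cy|exact: open_gt].
Qed.

(** * The phase estimate *)

(** The quantity atan (y' / (l S)), with S = sqrt (y ^ 2 + d ^ 2), is a smooth
substitute for the Pruefer phase of y folded onto ]- pi / 2, pi / 2[: as d tends
to 0 the folded phase has slope close to - l where y > 0 and + l where y < 0.
Adding d ^ 2 under the root keeps everything smooth at the zeros of y, and the
equation (s y')' = - l ^ 2 s y makes the terms of order l combine exactly into
l y / S. *)
Lemma smoothed_phase_derivative (R : realType) (l d : R)
    (s ds y dy ddy : R -> R) (x : R) : 0 < l -> 0 < d ->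
  is_derive x 1 s (ds x) -> is_derive x 1 y (dy x) ->
  is_derive x 1 dy (ddy x) ->
  s x * ddy x + ds x * dy x = - (l ^+ 2 * (s x * y x)) ->
  let S t := Num.sqrt (y t ^+ 2 + d ^+ 2) in
  is_derive x 1 (fun t => s t * atan (dy t / (l * S t)))
    (ds x * (atan (dy x / (l * S x))
             - l * dy x * S x / (l ^+ 2 * S x ^+ 2 + dy x ^+ 2))
     - l * (s x * (y x / S x))).
Proof.
move=> l0 d0 Ds Dy Ddy ode S.
have q0 : 0 < y x ^+ 2 + d ^+ 2 by have := sqr_ge0 (y x); nra.
have S0 : 0 < S x by rewrite sqrtr_gt0.
have S2 : S x ^+ 2 = y x ^+ 2 + d ^+ 2 by rewrite sqr_sqrtr // ltW.
have Dq : is_derive x 1 (fun t => y t ^+ 2 + d ^+ 2) (2 * y x * dy x).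
  apply: is_derive_eq; rewrite /GRing.scale /=; ring.
have DS : is_derive x 1 S (y x * dy x / S x).
  have := @is_derive1_comp R Num.sqrt (fun t => y t ^+ 2 + d ^+ 2) x _ _
    (is_derive1_sqrt q0) Dq.
  rewrite /comp -/(S x) => h; apply: is_derive_eq.
  by field; rewrite gt_eqF.
have lS : l * S x != 0 by rewrite mulf_neq0 ?gt_eqF.
have Dr : is_derive x 1 (fun t => dy t / (l * S t))
    ((ddy x - dy x * (y x * dy x) / S x ^+ 2) / (l * S x)).
  have h : is_derive x 1 (fun t => l * S t) (l * (y x * dy x / S x)).
    by apply: is_derive_eq; rewrite /GRing.scale /=; ring.
  have h2 := @is_deriveV R (fun t => l * S t) x _ _ lS h.
  apply: is_derive_eq; rewrite /GRing.scale /=.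
  by field; rewrite !gt_eqF.
have DA := @is_derive1_comp R atan (fun t => dy t / (l * S t)) x _ _
    (is_derive1_atan _) Dr.
rewrite /comp -/(S _) in DA.
apply: is_derive_eq; rewrite /GRing.scale /=.
have W0 : 0 < l ^+ 2 * S x ^+ 2 + dy x ^+ 2.
  by rewrite -exprMn ltr_pwDl ?sqr_ge0 // exprn_gt0 // mulr_gt0.
have -> : 1 + (dy x / (l * S x)) ^+ 2 =
    (l ^+ 2 * S x ^+ 2 + dy x ^+ 2) / (l * S x) ^+ 2.
  by field; rewrite !gt_eqF.
have e : s x * ddy x = - (l ^+ 2 * (s x * y x)) - ds x * dy x by lra.
transitivity (l * S x / (l ^+ 2 * S x ^+ 2 + dy x ^+ 2) *
    (s x * ddy x - s x * y x * dy x ^+ 2 / S x ^+ 2)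
    + atan (dy x / (l * S x)) * ds x).
  by congr (_ + _); field; rewrite exprMn !gt_eqF.
by rewrite e; field; rewrite ?exprMn !gt_eqF.
Qed.

(** The weighted phase takes the same value at both ends, so its derivative has
integral 0. Besides l s y / S that derivative only contains s' times a factor
bounded by pi / 2 + 1 / 2, uniformly in l and d. *)
Lemma smoothed_sign_integral_le (R : realType) (a b l d M : R)
    (s ds y dy ddy : R -> R) : a < b -> 0 < l -> 0 < d ->
  (forall x : R, is_derive x 1 s (ds x)) -> (forall x : R, is_derive x 1 y (dy x)) ->
  (forall x : R, is_derive x 1 dy (ddy x)) -> continuous ds ->
  (forall x, a < x < b ->
     s x * ddy x + ds x * dy x = - (l ^+ 2 * (s x * y x))) ->
  (forall x, `|ds x| <= M) ->
  let phase t := s t * atan (dy t / (l * Num.sqrt (y t ^+ 2 + d ^+ 2))) in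
  phase a = phase b ->
  l * `|\int[lebesgue_measure]_(x in `[a, b])
          (s x * (y x / Num.sqrt (y x ^+ 2 + d ^+ 2)))|
    <= M * (pi / 2 + 1 / 2) * (b - a).
Proof.
move=> ab l0 d0 Ds Dy Ddy cds ode dsM phase phaseab.
pose S t := Num.sqrt (y t ^+ 2 + d ^+ 2).
pose W t := l ^+ 2 * S t ^+ 2 + dy t ^+ 2.
pose E t := ds t * (atan (dy t / (l * S t)) - l * dy t * S t / W t).
pose f t := s t * (y t / S t).
have csqr (g : R -> R) : continuous g -> continuous (fun t => g t ^+ 2).
  move=> cg x; exact: (cvgM (cg x) (cg x)).
have cs := is_derive_continuous Ds; have cy := is_derive_continuous Dy.
have cdy := is_derive_continuous Ddy.
have S0 t : 0 < S t.
  by rewrite sqrtr_gt0; have := sqr_ge0 (y t); nra.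
have W0 t : 0 < W t.
  by rewrite /W -exprMn ltr_pwDl ?sqr_ge0 // exprn_gt0 // mulr_gt0.
have cS : continuous S.
  move=> x; apply: (@continuous_comp _ _ _ (fun t => y t ^+ 2 + d ^+ 2) Num.sqrt).
    by apply: cvgD; [exact: csqr|exact: cvg_cst].
  exact: sqrt_continuous.
have cr : continuous (fun t => dy t / (l * S t)).
  move=> x; apply: cvgM; first exact: cdy.
  apply: cvgV; first by rewrite mulf_neq0 ?gt_eqF.
  by apply: cvgM; [exact: cvg_cst|exact: cS].
have cE : continuous E.
  move=> x; apply: cvgM; first exact: cds.
  apply: cvgB.
    apply: (@continuous_comp _ _ _ (fun t => dy t / (l * S t)) atan).
      exact: cr.
    exact: continuous_atan.
  apply: cvgM.
    by apply: cvgM; [apply: cvgM; [exact: cvg_cst|exact: cdy]|exact: cS].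
  apply: cvgV; first by rewrite gt_eqF.
  apply: cvgD; last by exact: csqr.
  by apply: cvgM; [exact: cvg_cst|exact: csqr].
have cf : continuous f.
  move=> x; apply: cvgM; first exact: cs.
  apply: cvgM; first exact: cy.
  by apply: cvgV; [rewrite gt_eqF|exact: cS].
have intg := @integrable_continuous_itv R a b.
have DP x : a < x < b -> is_derive x 1 phase (E x - l * f x).
  by move=> /ode o; exact: smoothed_phase_derivative.
have cP : continuous phase.
  move=> x; apply: cvgM; first exact: cs.
  apply: (@continuous_comp _ _ _ (fun t => dy t / (l * S t)) atan).
    exact: cr.
  exact: continuous_atan.
have I0 : \int[lebesgue_measure]_(x in `[a, b]) (E x - l * f x) = 0.
  rewrite /Rintegral (@continuous_FTC2 _ _ phase) //.
  - by rewrite phaseab subee.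
  - apply: continuous_subspaceT => x; apply: cvgB; first exact: cE.
    by apply: cvgM; [exact: cvg_cst|exact: cf].
  - split.
    + by move=> x; rewrite in_itv /= => /DP[].
    + by apply: cvg_at_right_filter; exact: cP.
    + by apply: cvg_at_left_filter; exact: cP.
  - move=> x; rewrite in_itv /= => /DP ?.
    by rewrite derive1E derive_val.
have cf' : continuous (fun t => l * f t).
  by move=> x; apply: cvgM; [exact: cvg_cst|exact: cf].
rewrite RintegralB // in I0; [|exact: intg..].
rewrite RintegralZl // in I0; last exact: intg.
rewrite -[X in X * `|_|](gtr0_norm l0) -normrM.
move/eqP: I0; rewrite subr_eq0 => /eqP <-.
apply: (le_trans (le_normr_Rintegral _ _)) => //; first exact: intg.
rewrite [leRHS](_ : _ = \int[lebesgue_measure]_(x in `[a, b])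
    (M * (pi / 2 + 1 / 2))); last first.
  rewrite Rintegral_cst //; congr (_ * _); apply: esym.
  have h : lebesgue_measure (`[a, b]%classic : set R) = (b - a)%:E.
    by rewrite lebesgue_measure_itv /= lte_fin ab.
  exact: (congr1 fine h).
apply: le_Rintegral => //.
- by apply: (intg (fun x => `|E x|)) => x; apply: cvg_norm; exact: cE.
- by apply: (intg (fun=> _)) => x; exact: cvg_cst.
move=> x _; rewrite normrM ler_pM //.
rewrite (le_trans (ler_normB _ _)) // lerD //.
  by rewrite ler_norml !ltW ?atan_ltpi2 ?atan_gtNpi2.
(* This is 2 u v <= u ^ 2 + v ^ 2 for u = l S and v = |dy|. *)
rewrite normrM normfV (gtr0_norm (W0 x)) ler_pdivrMr //.
rewrite !normrM (gtr0_norm l0) (gtr0_norm (S0 x)) /W -[dy x ^+ 2]real_normK ?num_real //.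
by have := sqr_ge0 (l * S x - `|dy x|); nra.
Qed.

(** Negative parts are positive parts of - y, so one definition serves for both
signs. *)
Definition pos_mass (R : realType) (a b : R) (s y : R -> R) : R :=
  \int[lebesgue_measure]_(x in `[a, b] `&` [set x | 0 < y x]) s x.

(** The limit d -> 0 of [smoothed_sign_integral_le], by dominated convergence: y / S
tends to the sign of y. *)
Lemma sign_imbalance_le (R : realType) (a b l M : R)
    (s ds y dy ddy : R -> R) : a < b -> 0 < l ->
  (forall x : R, is_derive x 1 s (ds x)) ->
  (forall x : R, is_derive x 1 y (dy x)) ->
  (forall x : R, is_derive x 1 dy (ddy x)) -> continuous ds ->
  (forall x, a < x < b ->
     s x * ddy x + ds x * dy x = - (l ^+ 2 * (s x * y x))) ->
  (forall x, `|ds x| <= M) ->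
  (forall d, let phase t :=
       s t * atan (dy t / (l * Num.sqrt (y t ^+ 2 + d ^+ 2))) in
     phase a = phase b) ->
  l * `|pos_mass a b s y - pos_mass a b s (fun x => - y x)|
    <= M * (pi / 2 + 1 / 2) * (b - a).
Proof.
move=> ab l0 Ds Dy Ddy cds ode dsM phaseab.
have cs := is_derive_continuous Ds; have cy := is_derive_continuous Dy.
have cNy : continuous (fun x => - y x) by move=> x; apply: cvgN; exact: cy.
have mP := measurable_gt0 cy; have mN := measurable_gt0 cNy.
have intg := @integrable_continuous_itv R a b.
pose P := [set x | 0 < y x]; pose N := [set x | 0 < - y x].
have ir (A : set R) : measurable A ->
    lebesgue_measure.-integrable `[a, b] (EFin \o (s \_ A)).
  move=> mA; rewrite -restrict_EFin; apply/integrable_restrict => //.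
  apply: integrableS (intg _ cs) => //; exact: measurableI.
rewrite /pos_mass !Rintegral_mkcondr -RintegralB //; [|exact: ir..].
pose f x := (s \_ P) x - (s \_ N) x.
pose u_ n x := s x * (y x / Num.sqrt (y x ^+ 2 + harmonic n ^+ 2)).
rewrite -/P -/N.
have h0 n : 0 < harmonic n :> R by exact: harmonic_gt0.
have q0 n x : 0 < y x ^+ 2 + harmonic n ^+ 2.
  by rewrite ltr_wpDl ?sqr_ge0 // exprn_gt0.
have cu n : continuous (u_ n).
  move=> x; apply: cvgM; first exact: cs.
  apply: cvgM; first exact: cy.
  apply: cvgV; first by rewrite gt_eqF // sqrtr_gt0.
  apply: (@continuous_comp _ _ _ (fun t => y t ^+ 2 + harmonic n ^+ 2) Num.sqrt).
    by apply: cvgD; [exact: (cvgM (cy x) (cy x))|exact: cvg_cst].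
  exact: sqrt_continuous.
have ulim x : u_ n x @[n --> \oo] --> f x.
  (* At a zero of y both sides vanish, as 0 / 0 = 0. *)
  have -> : f x = s x * (y x / `|y x|).
    rewrite /f !patchE /P /N.
    case: (ltgtP (y x) 0) => yx.
    - rewrite memNset /=; last by apply/negP; rewrite -leNgt ltW.
      rewrite mem_set /= ?oppr_gt0 // ltr0_norm // invrN mulrN.
      by rewrite divff ?lt_eqF // mulrN1 sub0r.
    - rewrite mem_set // memNset /=; last by apply/negP; rewrite oppr_gt0 -leNgt ltW.
      by rewrite gtr0_norm // divff ?gt_eqF // mulr1 subr0.
    - by rewrite !memNset /= ?yx ?oppr0 ?ltxx // mul0r mulr0 ?subr0 ?addr0.
  apply: cvgM; first exact: cvg_cst.
  have [->|y0] := eqVneq (y x) 0.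
    by under eq_fun do rewrite mul0r; rewrite mul0r; exact: cvg_cst.
  apply: cvgM; first exact: cvg_cst.
  apply: cvgV; first by rewrite normr_eq0.
  rewrite -sqrtr_sqr -[y x ^+ 2 in X in _ --> X]addr0.
  apply: (@continuous_cvg _ _ _ _ _ _ Num.sqrt); first exact: sqrt_continuous.
  apply: cvgD; first exact: cvg_cst.
  by rewrite -[0](mul0r 0); apply: cvgM; exact: cvg_harmonic.
have if_ : lebesgue_measure.-integrable `[a, b] (EFin \o f).
  by rewrite /f; apply: (integrableB _ (ir _ mP) (ir _ mN)).
have igs : lebesgue_measure.-integrable `[a, b] (EFin \o (fun x => `|s x|)).
  by apply: intg => x; apply: cvg_norm; exact: cs.
have [|||||_ _ lim_u] := @dominated_convergence _ _ R lebesgue_measure `[a, b]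
  (measurable_itv _) (fun n x => (u_ n x)%:E) (EFin \o f) (EFin \o (fun x => `|s x|)).
- by move=> n; have /measurable_int := intg _ (cu n).
- exact: measurable_int if_.
- apply: aeW => x _; apply: cvg_EFin; last exact: ulim.
  exact: nearW.
- exact: igs.
- apply: aeW => x n _ /=; rewrite lee_fin normrM ler_piMr //.
  have r0 : 0 < Num.sqrt (y x ^+ 2 + harmonic n ^+ 2) by rewrite sqrtr_gt0.
  rewrite normrM normfV (gtr0_norm r0) ler_pdivrMr // mul1r -sqrtr_sqr.
  by rewrite ler_wsqrtr // lerDl sqr_ge0.
have : `|\int[lebesgue_measure]_(x in `[a, b]) u_ n x| @[n --> \oo] -->
    `|\int[lebesgue_measure]_(x in `[a, b]) f x|.
  apply: cvg_norm; apply: fine_cvg; rewrite fineK //.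
  exact: integrable_fin_num.
move=> lim_n; apply: cvgr_to_le (cvgM (cvg_cst l) lim_n) _.
apply: nearW => n; exact: (smoothed_sign_integral_le ab l0 (h0 n) Ds Dy Ddy).
Qed.

(** * Zero sets and total mass *)

(** Countable sets are Lebesgue null, so the zeros of y carry no mass. *)
Lemma pos_mass_total (R : realType) (a b : R) (s y : R -> R) :
  continuous s -> continuous y ->
  countable [set x | `[a, b]%classic x /\ y x = 0] ->
  pos_mass a b s y + pos_mass a b s (fun x => - y x) =
  \int[lebesgue_measure]_(x in `[a, b]) s x.
Proof.
move=> cs cy; set Z := [set x | _ /\ _] => cZ.
have cNy : continuous (fun x => - y x) by move=> x; apply: cvgN; exact: cy.
have mP := measurable_gt0 cy; have mN := measurable_gt0 cNy.
have is_ := integrable_continuous_itv a b cs.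
have disj : [disjoint `[a, b] `&` [set x | 0 < y x]
    & `[a, b] `&` [set x | 0 < - y x]].
  apply/disj_setPS => x [[_ /= h] [_ /=]].
  by rewrite oppr_gt0 => /(lt_trans h); rewrite ltxx.
have U : (`[a, b] `&` [set x | 0 < y x]) `|` (`[a, b] `&` [set x | 0 < - y x])
    = `[a, b] `\` Z.
  rewrite -setIUr; apply/seteqP; split => x [xab /= h]; split => //=.
    by move=> [_ y0]; case: h; rewrite y0 ?oppr0 ltxx.
  rewrite oppr_gt0; case: (ltgtP (y x) 0) => y0; [by right|by left|].
  by case: h.
have mZ : measurable (Z : set R).
  by apply: countable_measurable => // t; exact: measurable_set1.
rewrite /pos_mass -Rintegral_setU //.
- rewrite U /Rintegral; congr fine; apply/esym; apply: negligible_integral => //.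
  exact: countable_lebesgue_measure0.
- exact: measurableI.
- exact: measurableI.
- rewrite U; apply: integrableS is_ => //; exact: measurableD.
Qed.

Lemma pos_mass_imbalance_le (R : realType) (a b : R) (s y : R -> R) :
  continuous s -> continuous y -> (forall x, `[a, b]%classic x -> 0 <= s x) ->
  countable [set x | `[a, b]%classic x /\ y x = 0] ->
  `|pos_mass a b s y - pos_mass a b s (fun x => - y x)| <=
    \int[lebesgue_measure]_(x in `[a, b]) s x.
Proof.
move=> cs cy s0 zy; rewrite -(pos_mass_total cs cy zy).
have ge0 f : 0 <= pos_mass a b s f by apply: Rintegral_ge0 => x [/s0].
by rewrite (le_trans (ler_normB _ _)) // !ger0_norm.
Qed.

Lemma Rintegral_sin (R : realType) :
  \int[lebesgue_measure]_(x in `[0, pi]) sin x = 2 :> R.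
Proof.
rewrite /Rintegral (@continuous_FTC2 _ _ (fun x => - cos x)).
- by rewrite cospi cos0 /=; lra.
- exact: pi_gt0.
- by apply: continuous_subspaceT; exact: continuous_sin.
- have c : continuous (fun x : R => - cos x).
    by move=> x; apply: cvgN; exact: continuous_cos.
  split.
  + by move=> x _; exact: ex_derive.
  + by apply: cvg_at_right_filter; exact: c.
  + by apply: cvg_at_left_filter; exact: c.
- by move=> x _; rewrite derive1E derive_val opprK.
Qed.

Lemma Rintegral_one_2pi (R : realType) :
  \int[lebesgue_measure]_(x in `[0, (pi *+ 2 : R)]) 1 = pi *+ 2 :> R.
Proof.
rewrite Rintegral_cst // mul1r.
have h : lebesgue_measure (`[0, pi *+ 2]%classic : set R) = (pi *+ 2)%:E.
  by rewrite lebesgue_measure_itv /= lte_fin mulrn_wgt0 ?pi_gt0 // sube0.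
exact: (congr1 fine h).
Qed.

Lemma countable_zeros_sin (R : realType) :
  countable [set x : R | 0 <= x /\ sin x = 0].
Proof.
suff : [set x : R | 0 <= x /\ sin x = 0] `<=` range (fun k : nat => pi *+ k : R).
  move=> /subset_card_le/sub_countable; apply.
  exact: sub_countable (card_image_le _ _) (countableP _).
move=> x [x0 sx].
have p0 := pi_gt0 R.
have /andP[k1 k2] := truncn_itv (divr_ge0 x0 (ltW p0)).
(* The only zero of sin on [k pi, (k + 1) pi[ is k pi. *)
set k := Num.truncn _ in k1 k2.
exists k => //; apply/eqP; rewrite eq_le; apply/andP; split.
  by rewrite -mulr_natl -ler_pdivlMr.
rewrite leNgt; apply/negP => kx.
have : 0 < sin (x - pi *+ k).
  apply: sin_gt0_pi; rewrite subr_gt0 kx /=.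
  by move: k2; rewrite ltr_pdivrMr // mulr_natl mulrS; lra.
have /esym/eqP := alternatingn (@sinDpi R) k (x - pi *+ k).
by rewrite subrK sx mulf_eq0 signr_eq0 /= => /eqP ->; rewrite ltxx.
Qed.

Lemma countable_zeros_sin_affine (R : realType) (m : nat) (c : R) (A : set R) :
  (0 < m)%N -> 0 <= c -> A `<=` [set x | 0 <= x] ->
  countable [set x : R | A x /\ sin (m%:R * x + c) = 0].
Proof.
move=> m0 c0 A0; have m0R : m%:R != 0 :> R by rewrite pnatr_eq0 -lt0n.
suff : [set x : R | A x /\ sin (m%:R * x + c) = 0] `<=`
    (fun z => (z - c) / m%:R) @` [set x : R | 0 <= x /\ sin x = 0].
  move=> /subset_card_le/sub_countable; apply.
  exact: sub_countable (card_image_le _ _) (countable_zeros_sin R).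
move=> x [/A0 /= x0 sx]; exists (m%:R * x + c); last by rewrite addrK mulrAC divff ?mul1r.
by split => //; rewrite addr_ge0 ?mulr_ge0.
Qed.

Lemma finite_roots (R : realType) (p : {poly R}) : p != 0 ->
  finite_set [set t | root p t].
Proof.
move=> p0; apply: contrapT => /(infinite_set_fset (size p)) [B sB].
apply/negP; rewrite -ltnNge; apply: max_poly_roots => //.
  by apply/allP => t tB; exact: sB.
exact: finmap.fset_uniq.
Qed.

(** Since t = acos (cos t) on [0, pi], the zeros are among the images under acos
of the roots of the polynomial (1 - X ^ 2) p. *)
Lemma countable_zeros_trig_poly (R : realType) (m : nat) (p : {poly R}) : p != 0 ->
  countable [set t : R | `[0, pi]%classic t
    /\ (-1) ^+ m * Num.sqrt (1 - cos t ^+ 2) ^+ m * p.[cos t] = 0].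
Proof.
move=> p0; set Z := [set t | _].
have q0 : (1 - 'X^2) * p != 0.
  rewrite mulf_neq0 // -oppr_eq0 opprB -size_poly_eq0.
  by rewrite -['X^2 - 1]/('X^2 - 1%:P) size_XnsubC.
suff : Z `<=` (@acos R) @` [set t | root ((1 - 'X^2) * p) t].
  move=> /subset_card_le/sub_countable; apply.
  exact: sub_countable (card_image_le _ _) (finite_set_countable (finite_roots q0)).
move=> t [/= tpi /eqP Ft]; exists (cos t); last exact: cosK.
move: Ft; rewrite rootM !mulf_eq0 signr_eq0 /= => /orP[|pt]; last first.
  by apply/orP; right.
rewrite expf_eq0 => /andP[_]; rewrite sqrtr_eq0 => ct; apply/orP; left.
by rewrite rootE !hornerE eq_le ct subr_ge0 -(cos2Dsin2 t) lerDl sqr_ge0.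
Qed.

(** * Areas of the sign sets of a separated function *)

(** Tonelli's theorem on a rectangle, for a function of the first coordinate. *)
Lemma integral_prod_fst (R : realType) (X Y : set R) (f : R -> R) :
  measurable X -> measurable Y -> measurable_fun setT f ->
  (forall x, X x -> 0 <= f x) ->
  (\int[lebesgue_measure \x lebesgue_measure]_(p in X `*` Y) (f p.1)%:E =
   \int[lebesgue_measure]_(x in X) (f x)%:E * lebesgue_measure Y)%E.
Proof.
move=> mX mY mf f0.
have mfX : measurable_fun [set: R] (f \_ X).
  by apply/(measurable_restrictT f mX); apply: measurable_funTS.
rewrite integral_mkcond fubini_tonelli1 /=; last 2 first.
- apply/(measurable_restrictT (fun p : R * R => (f p.1)%:E) (measurableX mX mY)).
  apply: measurable_funTS; apply/measurable_EFinP.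
  exact: (measurableT_comp mf measurable_fst).
- move=> [x y]; rewrite patchE /=; case: ifPn => // /set_mem[/= Xx _].
  by rewrite lee_fin f0.
have -> : (\int[lebesgue_measure]_(x in X) (f x)%:E =
    \int[lebesgue_measure]_x ((f \_ X) x)%:E)%E.
  rewrite integral_mkcond; apply: eq_integral => x _.
  by rewrite !patchE; case: ifPn.
rewrite -ge0_integralZr //; last 2 first.
- exact/measurable_EFinP.
- by move=> x _; rewrite patchE lee_fin; case: ifPn => // /set_mem; exact: f0.
apply: eq_integral => x _; rewrite /fubini_F /= -integral_cst //.
rewrite [RHS]integral_mkcond; apply: eq_integral => y _.
rewrite !patchE !in_setX /=.
by case: (x \in X); case: (y \in Y).
Qed.

(** A product is positive where both factors are positive or both are negative,
so the positive set is, in spherical coordinates, a disjoint union of two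
rectangles. *)
Lemma vol_separated (R : realType) (psi : sphere2 R -> R) (F G : R -> R) :
  continuous F -> continuous G ->
  (forall t q, 0 <= t <= pi -> psi (spherical t q) = F t * G q) ->
  fine (vol [set x | 0 < psi x]) =
    pos_mass 0 pi sin F * pos_mass 0 (pi *+ 2) (fun=> 1) G
    + pos_mass 0 pi sin (fun t => - F t)
      * pos_mass 0 (pi *+ 2) (fun=> 1) (fun q => - G q).
Proof.
move=> cF cG psiE.
have cNF : continuous (fun t => - F t) by move=> x; apply: cvgN; exact: cF.
have cNG : continuous (fun q => - G q) by move=> x; apply: cvgN; exact: cG.
pose X (f : R -> R) := `[0, pi]%classic `&` [set t | 0 < f t].
pose Y (g : R -> R) := `[0, pi *+ 2[%classic `&` [set q | 0 < g q].
have mX f : continuous f -> measurable (X f).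
  by move=> cf; apply: measurableI => //; exact: measurable_gt0.
have mY f : continuous f -> measurable (Y f).
  by move=> cf; apply: measurableI => //; exact: measurable_gt0.
have msin : measurable_fun [set: R] (@sin R).
  by apply: continuous_measurable_fun; exact: continuous_sin.
have sX f x : X f x -> 0 <= sin x.
  by move=> [] /=; rewrite in_itv /= => /sin_ge0_pi.
have piece f g : continuous f -> continuous g ->
    (\int[lebesgue_measure \x lebesgue_measure]_(p in X f `*` Y g) (sin p.1)%:E =
    (pos_mass 0 pi sin f * pos_mass 0 (pi *+ 2) (fun=> 1) g)%:E)%E.
  move=> cf cg; rewrite (integral_prod_fst (mX f cf) (mY g cg) msin (sX f)).
  rewrite EFinM; congr (_ * _)%E.
    rewrite /pos_mass /Rintegral fineK //; apply: integrable_fin_num; first exact: mX.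
    apply: integrableS (integrable_continuous_itv _ _ (@continuous_sin R)) => //.
    exact: mX.
  have iy (A : set R) : measurable A -> A `<=` `[0, pi *+ 2] ->
      lebesgue_measure.-integrable A (EFin \o (fun=> 1 : R)).
    move=> mA sA; 
    have c1 : continuous (fun _ : R => 1 : R) by move=> x; exact: cvg_cst.
    have i1 := integrable_continuous_itv 0 (pi *+ 2) c1.
    by apply: integrableS i1.
  rewrite -[LHS]mul1e -integral_cst; last exact: mY.
  (* Azimuths range over [0, 2 pi[; adding the point 2 pi changes no integral. *)
  have -> : pos_mass 0 (pi *+ 2) (fun=> 1) g =
      \int[lebesgue_measure]_(x in Y g) 1.
    rewrite /pos_mass /Y !Rintegral_mkcondr Rintegral_itv_bndo_bndc //.
    rewrite -restrict_EFin; apply/integrable_restrict => //.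
      exact: measurable_gt0.
    apply: (iy (Y g)); first exact: mY.
    by move=> x [/=]; rewrite !in_itv /= => /andP[-> /ltW ->].
  rewrite /Rintegral fineK //; apply: integrable_fin_num; first exact: mY.
  apply: (iy (Y g)); first exact: mY.
  by move=> x [/=]; rewrite !in_itv /= => /andP[-> /ltW ->].
rewrite /vol.
have -> : [set p : R * R | [/\ 0 <= p.1 <= pi, 0 <= p.2 < pi *+ 2
    & [set x | 0 < psi x] (spherical p.1 p.2)]] =
    (X F `*` Y G) `|` (X (fun t => - F t) `*` Y (fun q => - G q)).
  apply/seteqP; split => [[t q] /=|[t q] /= ].
    move=> [t1 q1]; rewrite psiE // => FG.
    rewrite /X /Y /= !in_itv /= t1 q1 !oppr_gt0.
    case: (ltgtP (F t) 0) FG => [Ft|Ft|->]; last by rewrite mul0r ltxx.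
      by rewrite nmulr_rgt0 // => Gq; right.
    by rewrite pmulr_rgt0 // => Gq; left.
  rewrite /X /Y /= !in_itv /= !oppr_gt0.
  move=> [[[t1 Ft] [q1 Gq]]|[[t1 Ft] [q1 Gq]]]; split => //; rewrite psiE //.
    exact: mulr_gt0.
  by rewrite nmulr_rgt0.
rewrite ge0_integral_setU /=.
- by rewrite !piece.
- exact: (measurableX (mX _ _) (mY _ _)).
- exact: (measurableX (mX _ _) (mY _ _)).
- apply: measurable_funTS; apply/measurable_EFinP.
  exact: (measurableT_comp msin measurable_fst).
- by move=> [t q] [[] /sX|[] /sX] /=; rewrite lee_fin.
- apply/disj_setPS => -[t q] [[[_ /= a] _] [[_ /= b] _]].
  by move: b; rewrite oppr_gt0 => /(lt_trans a); rewrite ltxx.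
Qed.

(** For a product F G, the difference of the positive and negative areas is the
product of the differences for the two factors: integrate
sign (F G) = sign F sign G. Hence it is small as soon as one factor is nearly
balanced. *)
Lemma vol_sign_split (R : realType) (psi : sphere2 R -> R) (F G : R -> R) :
  continuous F -> continuous G ->
  (forall t q, 0 <= t <= pi -> psi (spherical t q) = F t * G q) ->
  countable [set t | `[0, pi]%classic t /\ F t = 0] ->
  countable [set q | `[0, pi *+ 2]%classic q /\ G q = 0] ->
  let V := fine (vol [set x | 0 < psi x]) in
  let W := fine (vol [set x | psi x < 0]) in
  V + W = 4 * pi /\
  V - W = (pos_mass 0 pi sin F - pos_mass 0 pi sin (fun t => - F t)) *
    (pos_mass 0 (pi *+ 2) (fun=> 1) G
     - pos_mass 0 (pi *+ 2) (fun=> 1) (fun q => - G q)).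
Proof.
move=> cF cG psiE zF zG V W.
have c1 : continuous (fun _ : R => 1 : R) by move=> x; exact: cvg_cst.
have cNF : continuous (fun t => - F t) by move=> x; apply: cvgN; exact: cF.
have VE := vol_separated cF cG psiE.
have NE t q : 0 <= t <= pi -> - psi (spherical t q) = - F t * G q.
  by move=> /psiE ->; rewrite mulNr.
have WE := @vol_separated R (fun x => - psi x) _ _ cNF cG NE.
have N2 : (fun t => - - F t) = F by apply/funext => t; rewrite opprK.
have N3 : [set x | 0 < - psi x] = [set x | psi x < 0].
  by apply/seteqP; split => x /=; rewrite oppr_gt0.
rewrite N2 N3 in WE.
have sF := pos_mass_total (@continuous_sin R) cF zF.
rewrite Rintegral_sin in sF.
have sG := pos_mass_total c1 cG zG.
rewrite Rintegral_one_2pi in sG; rewrite /V /W VE WE.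
set a := pos_mass _ _ _ _ in sF *; set b := pos_mass _ _ _ _ in sF *.
set c := pos_mass _ _ _ _ in sG *; set d := pos_mass _ _ _ _ in sG *.
split; last by ring.
transitivity ((a + b) * (c + d)); first by ring.
by rewrite sF sG; ring.
Qed.

(** * The azimuthal and polar factors *)

Lemma is_derive_sin_affine (R : realType) (k c x : R) :
  is_derive x 1 (fun t => sin (k * t + c)) (k * cos (k * x + c)).
Proof.
have h : is_derive x 1 (fun t : R => k * t + c) k.
  by apply: is_derive_eq; rewrite /GRing.scale /=; ring.
have := @is_derive1_comp R sin (fun t => k * t + c) x _ _ (is_derive_sin _) h.
by rewrite mulrC.
Qed.

Lemma is_derive_cos_affine (R : realType) (k c x : R) :
  is_derive x 1 (fun t => cos (k * t + c)) (- (k * sin (k * x + c))).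
Proof.
have h : is_derive x 1 (fun t : R => k * t + c) k.
  by apply: is_derive_eq; rewrite /GRing.scale /=; ring.
have := @is_derive1_comp R cos (fun t => k * t + c) x _ _ (is_derive_cos _) h.
by rewrite mulrC mulrN.
Qed.

(** y'' = - m ^ 2 y is the equation of the phase estimate for the weight s = 1, and
periodicity supplies the equality of the phases at the two ends. As s' = 0, the
estimate becomes an equality. The shift c lets sine and cosine be treated
together. *)
Lemma sin_affine_balanced (R : realType) (m : nat) (c : R) : (0 < m)%N ->
  let y q := sin (m%:R * q + c) in
  pos_mass 0 (pi *+ 2) (fun=> 1) y = pos_mass 0 (pi *+ 2) (fun=> 1) (fun q => - y q).
Proof.
move=> m0 y; have m0R : 0 < m%:R :> R by rewrite ltr0n.
pose dy (x : R) := m%:R * cos (m%:R * x + c).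
pose ddy (x : R) := m%:R * - (m%:R * y x).
have Ddy (x : R) : is_derive x 1 dy (ddy x).
  have h := is_derive_cos_affine m%:R c x.
  by apply: is_derive_eq.
have shift : m%:R * (pi *+ 2) + c = m%:R * 0 + c + pi *+ 2 *+ m :> R.
  by rewrite mulr0 add0r addrC mulr_natl.
have y2 : y (pi *+ 2) = y 0 by rewrite /y shift periodicn //; exact: sinD2pi.
have dy2 : dy (pi *+ 2) = dy 0.
  by rewrite /dy shift periodicn //; exact: cosD2pi.
have p2 : 0 < pi *+ 2 :> R by rewrite mulrn_wgt0 // pi_gt0.
(* The weight is constant, so the bound on the derivative of the weight is 0. *)
have /= := @sign_imbalance_le R 0 (pi *+ 2) m%:R 0 (fun=> 1) (fun=> 0) y dy ddy
  p2 m0R _ (is_derive_sin_affine _ _) Ddy _ _ _ _.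
rewrite !mul0r => h; apply/eqP; rewrite -subr_eq0 -normr_le0.
rewrite -(pmulr_rle0 _ m0R); apply: h => //.
- by move=> x; exact: cvg_cst.
- by move=> x _; rewrite /ddy; ring.
- by move=> x; rewrite normr0.
- by move=> d; rewrite y2 dy2.
Qed.

Lemma is_derive_poly_cos (R : realType) (p : {poly R}) (x : R) :
  is_derive x 1 (fun t => p.[cos t]) (- (sin x * p^`().[cos x])).
Proof.
have := @is_derive1_comp R (horner p) cos x _ _ (is_derive_poly p _) (is_derive_cos x).
by rewrite mulrN mulrC.
Qed.

(** The phase estimate for the weight s = sin: it vanishes at both poles, which
makes the weighted phases agree at the two ends. *)
Lemma poly_cos_imbalance (R : realType) (p : {poly R}) (l : R) : 0 < l ->
  (forall t, 0 < t < pi ->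
     derive1 (fun u => sin u * derive1 (fun v => p.[cos v]) u) t =
     - (l ^+ 2 * (sin t * p.[cos t]))) ->
  l * `|pos_mass 0 pi sin (fun t => p.[cos t])
        - pos_mass 0 pi sin (fun t => - p.[cos t])| <= (pi / 2 + 1 / 2) * pi.
Proof.
move=> l0 ode; pose dy (x : R) := - (sin x * p^`().[cos x]).
pose ddy (x : R) := - (cos x * p^`().[cos x] - sin x ^+ 2 * p^`()^`().[cos x]).
have Ddy (x : R) : is_derive x 1 dy (ddy x).
  have h := is_derive_poly_cos p^`() x.
  by apply: is_derive_eq; rewrite /ddy /GRing.scale /=; ring.
have dyE : derive1 (fun v => p.[cos v]) = dy.
  apply/funext => x; have h := is_derive_poly_cos p x.
  by rewrite derive1E derive_val.
have := @sign_imbalance_le R 0 pi l 1 sin cos (fun t => p.[cos t]) dy ddy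
  (pi_gt0 R) l0 (@is_derive_sin R) (is_derive_poly_cos p) Ddy (@continuous_cos R).
rewrite mul1r subr0; apply.
- move=> t /ode <-; rewrite dyE derive1E.
  have h := Ddy t.
  by rewrite derive_val /GRing.scale /=; ring.
- exact: cos_max.
- by move=> d /=; rewrite sin0 sinpi !mul0r.
Qed.

Lemma continuous_assoc_legendre_cos (R : realType) (n m : nat) :
  continuous (fun t : R => assoc_legendre n m (cos t)).
Proof.
move=> t; apply: cvgM.
  apply: cvgM; first exact: cvg_cst.
  apply: (@continuous_comp _ _ _ (fun t : R => Num.sqrt (1 - cos t ^+ 2))
    (fun u : R => u ^+ m)); last exact: exprn_continuous.
  apply: (@continuous_comp _ _ _ (fun t : R => 1 - cos t ^+ 2) Num.sqrt).
    apply: cvgB; first exact: cvg_cst.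
    exact: (cvgM (@continuous_cos R t) (@continuous_cos R t)).
  exact: sqrt_continuous.
exact: (is_derive_continuous (is_derive_poly_cos (derivn m (legendre R n)))).
Qed.

(** * The basis functions in spherical coordinates *)

Lemma cos_polar_spherical (R : realType) (t q : R) :
  cos (polar_angle (spherical t q)) = cos t.
Proof.
by rewrite /polar_angle /zcoord /= acosK // in_itv /= cos_geN1 cos_le1.
Qed.

Lemma zonal_spherical (R : realType) (k : nat) (t q : R) :
  zonal k (spherical t q) = (legendre R k).[cos t].
Proof. by rewrite /zonal cos_polar_spherical. Qed.

(** An angle known only through its cosine and sine, as the azimuth is, still has
well defined cosines and sines of its integer multiples. *)
Lemma cos_sin_mulrn (R : realType) (a b : R) (m : nat) :
  cos a = cos b -> sin a = sin b ->
  cos (m%:R * a) = cos (m%:R * b) /\ sin (m%:R * a) = sin (m%:R * b).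
Proof.
move=> ca sa; elim: m => [|m [IHc IHs]]; first by rewrite !mul0r.
by rewrite -natr1 !mulrDl !mul1r !cosD !sinD IHc IHs ca sa.
Qed.

Lemma azimuth_spherical (R : realType) (t q : R) : 0 <= t <= pi -> sin t != 0 ->
  cos (azimuth (spherical t q)) = cos q /\ sin (azimuth (spherical t q)) = sin q.
Proof.
move=> tpi st; have := spherical_polar_azimuth (spherical t q).
rewrite {1}/polar_angle {1}/zcoord /= cosK // => e.
have e1 := congr1 (@xcoord R) e; have e2 := congr1 (@ycoord R) e.
by split; [move: e1|move: e2]; rewrite /xcoord /ycoord /= => /(mulfI st).
Qed.

Lemma harmonic_spherical (R : realType) (n m : nat) (t q : R) : (0 < m)%N ->
  0 <= t <= pi ->
  harmonic_cos n m (spherical t q) = assoc_legendre n m (cos t) * cos (m%:R * q)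
  /\ harmonic_sin n m (spherical t q) = assoc_legendre n m (cos t) * sin (m%:R * q).
Proof.
move=> m0 tpi; rewrite /harmonic_cos /harmonic_sin cos_polar_spherical.
(* At a pole the azimuth is arbitrary, but m > 0 makes both sides vanish. *)
have [st|st] := eqVneq (sin t) 0.
  have -> : assoc_legendre n m (cos t) = 0.
    rewrite /assoc_legendre -sin2cos2 st expr0n /= sqrtr0.
    by rewrite expr0n gtn_eqF // mulr0 mul0r.
  by rewrite !mul0r.
have [ca sa] := azimuth_spherical q tpi st.
by have [-> ->] := cos_sin_mulrn m ca sa.
Qed.

(** * The limit *)

(** For m > 0 the azimuthal factor is exactly balanced, and the two areas agree.
For a zonal function the azimuthal factor is constant and the polar one is
controlled by the phase estimate with l ^ 2 = n (n + 1) >= n ^ 2, the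
differential equation being read off from the eigenvalue equation. *)
Lemma basis_vol_imbalance (R : realType) (psi : sphere2 R -> R) (n : nat) :
  (0 < n)%N -> standard_basis psi -> is_eigenfunction psi (n * (n + 1))%:R ->
  let V := fine (vol [set x | 0 < psi x]) in
  let W := fine (vol [set x | psi x < 0]) in
  V + W = 4 * pi /\ n%:R * `|V - W| <= (pi / 2 + 1 / 2) * pi * (pi *+ 2).
Proof.
move=> n0 [k [->|[m [/andP[m0 mk] psiE]]]] [[x px] eig] V W; rewrite /V /W.
  pose P := legendre R k.
  have P0 : P != 0.
    by apply: contra_neq px => P0; rewrite /zonal -/P P0 horner0.
  have cF := is_derive_continuous (is_derive_poly_cos P).
  have c1 : continuous (fun _ : R => 1 : R) by move=> y; exact: cvg_cst.
  have zF : countable [set t : R | `[0, pi]%classic t /\ P.[cos t] = 0].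
    have := countable_zeros_trig_poly 0 P0.
    by under eq_set do rewrite !expr0 !mul1r.
  have z1 : countable [set q : R | `[0, pi *+ 2]%classic q /\ (1 : R) = 0].
    rewrite [X in countable X](_ : _ = set0); first exact: countable0.
    by apply/seteqP; split => q //= [_ /eqP]; rewrite oner_eq0.
  have psiE (t q : R) : 0 <= t <= pi ->
      zonal k (spherical t q) = P.[cos t] * (fun=> 1) q.
    by rewrite zonal_spherical mulr1.
  have [-> ->] := vol_sign_split cF c1 psiE zF z1; split => //.
  have g2 := pos_mass_imbalance_le c1 c1 (fun _ _ => ler01) z1.
  rewrite Rintegral_one_2pi in g2.
  pose lam : R := (n * (n + 1))%:R.
  have lam0 : 0 < lam by rewrite ltr0n muln_gt0 n0 addn1.
  have l0 : 0 < Num.sqrt lam by rewrite sqrtr_gt0.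
  have nl : n%:R <= Num.sqrt lam.
    rewrite -[n%:R]ger0_norm // -sqrtr_sqr ler_wsqrtr // -natrX ler_nat.
    by rewrite leq_mul2l leq_addr orbT.
  rewrite normrM mulrA ler_pM ?mulr_ge0 //.
  apply: le_trans _ (poly_cos_imbalance (p := P) l0 _); first by rewrite ler_wpM2r.
  (* The eigenvalue equation on the meridian of azimuth 0, where the azimuthal
     term vanishes, is the equation required. *)
  move=> t tpi; have st : sin t != 0 by rewrite gt_eqF // sin_gt0_pi.
  have := eig t 0 tpi; rewrite /laplace_beltrami sqr_sqrtr ?ltW // -/lam.
  have -> : (fun s => zonal k (spherical s 0)) = (fun s => P.[cos s]).
    by apply/funext => s; rewrite zonal_spherical.
  have -> : (fun p => zonal k (spherical t p)) = (fun=> P.[cos t]).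
    by apply/funext => s; rewrite zonal_spherical.
  rewrite zonal_spherical -/P.
  have -> : derive1 (fun q : R => derive1 (fun=> P.[cos t]) q) 0 = 0.
    by under eq_fun do rewrite derive1_cst; rewrite derive1_cst.
  rewrite mulr0 addr0 => e.
  by rewrite [lam * _]mulrCA -e mulrN mulrA divff // mul1r opprK.
pose Q := derivn m (legendre R k).
have Q0 : Q != 0.
  apply: contra_neq px => Q0.
  have z (t : R) : assoc_legendre k m t = 0.
    by rewrite /assoc_legendre -/Q Q0 horner0 mulr0.
  by case: psiE => ->; rewrite /harmonic_cos /harmonic_sin z mul0r.
have [c [c0 psiE']] : exists c : R, 0 <= c /\ forall t q, 0 <= t <= pi ->
    psi (spherical t q) = assoc_legendre k m (cos t) * sin (m%:R * q + c).
  case: psiE => ->.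
    exists (pi / 2); split; first by rewrite divr_ge0 ?pi_ge0.
    by move=> t q /(harmonic_spherical k q m0)[-> _]; rewrite sinDpihalf.
  exists 0; split => // t q /(harmonic_spherical k q m0)[_ ->].
  by rewrite addr0.
have cG := is_derive_continuous (is_derive_sin_affine m%:R c).
have zF := countable_zeros_trig_poly m Q0.
have zG : countable [set q : R | `[0, pi *+ 2]%classic q /\ sin (m%:R * q + c) = 0].
  by apply: countable_zeros_sin_affine => // q; rewrite /= in_itv /= => /andP[].
have [-> ->] := vol_sign_split (@continuous_assoc_legendre_cos R k m) cG psiE' zF zG.
split => //; rewrite (sin_affine_balanced c m0) subrr mulr0 normr0 mulr0.
by have p0 := pi_gt0 R; apply: mulr_ge0; [apply: mulr_ge0|]; lra.
Qed.

Unset Implicit Arguments.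
Set Strict Implicit.

Theorem theorem1p5 (R : realType) (psi : nat -> sphere2 R -> R)
  (psi_basis : forall n, (1 <= n)%N -> standard_basis (psi n))
  (psi_eigen : forall n, (1 <= n)%N ->
     is_eigenfunction (psi n) (n * (n + 1))%:R) :
  (fine (vol [set x | 0 < psi n x]) / fine (vol [set x | psi n x < 0]))
    @[n --> \oo] --> (1 : R).
Proof.
pose V n := fine (vol [set x | 0 < psi n x]).
pose W n := fine (vol [set x | psi n x < 0]).
pose C : R := (pi / 2 + 1 / 2) * pi * (pi *+ 2).
pose d n : R := V n - W n.
have est n : (0 < n)%N -> V n + W n = 4 * pi /\ n%:R * `|d n| <= C.
  move=> n0; exact: basis_vol_imbalance n0 (psi_basis n n0) (psi_eigen n n0).
have d0 : d n @[n --> \oo] --> 0.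
  apply/norm_cvg0P.
  apply: (@squeeze_cvgr _ _ _ _ (fun=> 0) (fun n => C * 2 * harmonic n)).
  - near=> n; rewrite normr_ge0 /=.
    have n0 : (0 < n)%N by near: n; exists 1%N.
    have [_] := est n n0; rewrite /harmonic /= ler_pdivlMr ?ltr0n //.
    (* harmonic n is 1 / (n + 1), and 1 / n <= 2 / (n + 1). *)
    have : n.+1%:R <= 2 * n%:R :> R
      by rewrite -natrM ler_nat mul2n -addnn -addn1 leq_add2l.
    by have := normr_ge0 (d n); nra.
  - exact: cvg_cst.
  - by rewrite -[0](mulr0 (C * 2)); apply: cvgM; [exact: cvg_cst|exact: cvg_harmonic].
have p0 := pi_gt0 R.
have lim : (4 * pi + d n) / (4 * pi - d n) @[n --> \oo] --> (1 : R).
  rewrite [X in _ --> X](_ : 1 = (4 * pi + 0) / (4 * pi - 0)); last first.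
    by rewrite addr0 subr0 divff // gt_eqF // mulr_gt0.
  apply: cvgM; first by apply: cvgD => //; exact: cvg_cst.
  apply: cvgV; first by rewrite subr0 gt_eqF // mulr_gt0.
  by apply: cvgB => //; exact: cvg_cst.
apply: cvg_trans lim; apply: near_eq_cvg; near=> n.
have n0 : (0 < n)%N by near: n; exists 1%N.
have [VW _] := est n n0; rewrite -/(V n) -/(W n) -VW /d.
rewrite [V n + _ + _](_ : _ = V n * 2); last by ring.
rewrite [V n + _ - _](_ : _ = W n * 2); last by ring.
by rewrite -mulf_div divff ?mulr1.
Unshelve. all: by end_near. Qed.
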